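(* Let $R$ be an associative ring with identity, let $M$ be a finitely presented left $R$-module and $N$ a left $R$-module. Then $N\in\mathfrak{F}^{-1}(M)$ if and only if $N^+\in\mathcal{A}p(M)$.
   Context: Modules are unital left $R$-modules unless stated otherwise; $N^+=\mathrm{Hom}_{\mathbb{Z}}(N,\mathbb{Q}/\mathbb{Z})$ is the character module of $N$ (a right $R$-module when $N$ is a left one). A flat precover of a module $N$ is a morphism $g:F\to N$ with $F$ flat such that $\mathrm{Hom}(F',F)\to\mathrm{Hom}(F',N)$ is surjective for every flat module $F'$. The flat-precover completing domain $\mathfrak{F}^{-1}(M)$ is the class of all left $R$-modules $N$ such that for every morphism $f:M\to N$ and every flat precover $g:F\to N$ there is a morphism $h:M\to F$ with $gh=f$. For a left $R$-module $M$, the absolutely pure domain $\mathcal{A}p(M)$ is the class of all right $R$-modules $L$ that are absolutely $M$-pure, i.e. such that $L\otimes_R M\to K\otimes_R M$ is a monomorphism for every right $R$-module $K$ containing $L$ as a submodule. *)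

(* Defs.v *)
From HB Require Import structures.
From mathcomp Require Import all_boot all_order all_algebra.
From mathcomp Require Import ring_quotient.
From mathcomp Require Import boolp functions.
From mathcomp.multinomials Require Import freeg.

Set Implicit Arguments.
Unset Strict Implicit.
Unset Printing Implicit Defensive.

Import GRing.Theory.
Local Open Scope ring_scope.
Local Open Scope quotient_scope.

(* Left R-modules are lmodType R and right R-modules are lmodType R^c, so that
   r *: x in a right module stands for x r. Rings may be trivial (pzRingType). *)

Definition rat_mod_int : zmodType :=
  Quotient.quot (Num.int_num_subdef : {pred rat}).

Section Character.

Variables (R : pzRingType) (N : lmodType R).

Definition is_character : pred (N -> rat_mod_int) :=
  fun f => `[< zmod_morphism f >].

Record character := Character {
  character_fun :> N -> rat_mod_int;
  _ : is_character character_fun }.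

HB.instance Definition _ := [isSub for character_fun].
HB.instance Definition _ := [Choice of character by <:].

Fact character_zmod_closed : zmod_closed is_character.
Proof.
split=> [|f g /asboolP fB /asboolP gB]; apply/asboolP => x y /=.
  by rewrite [RHS]subrr.
rewrite -[LHS]/(f (x - y) - g (x - y)) fB gB.
rewrite -[RHS]/((f x - g x) - (f y - g y)) !opprB addrACA [RHS]addrACA.
by rewrite [- g x - _]addrC.
Qed.

HB.instance Definition _ := GRing.isZmodClosed.Build _ is_character
  character_zmod_closed.
HB.instance Definition _ := [SubChoice_isSubZmodule of character by <:].

Fact character_is_zmod_morphism (f : character) : zmod_morphism f.
Proof. by case: f => f fP; apply/asboolP. Qed.

HB.instance Definition _ (f : character) :=
  GRing.isZmodMorphism.Build N rat_mod_int f (character_is_zmod_morphism f).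

Fact character_scale_subproof (r : R) (f : character) :
  is_character (fun x => f (r *: x)).
Proof. by apply/asboolP => x y; rewrite scalerBr raddfB. Qed.

Definition character_scale (r : R^c) (f : character) : character :=
  Character (character_scale_subproof r f).

Fact character_scaleA (a b : R^c) f :
  character_scale a (character_scale b f) = character_scale (a * b) f.
Proof. by apply/val_inj/funext => x /=; rewrite scalerA. Qed.

Fact character_scale1 : left_id 1 character_scale.
Proof. by move=> f; apply/val_inj/funext => x /=; rewrite scale1r. Qed.

Fact character_scaleDr : right_distributive character_scale +%R.
Proof. by move=> a f g; apply/val_inj/funext. Qed.

Fact character_scaleDl f : {morph character_scale^~ f : a b / a + b}.
Proof.
by move=> a b; apply/val_inj/funext => x /=; rewrite scalerDl raddfD.
Qed.

HB.instance Definition _ := GRing.Zmodule_isLmodule.Build R^c character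
  character_scaleA character_scale1 character_scaleDr character_scaleDl.

End Character.

Section Tensor.

Variables (R : pzRingType) (L : lmodType R^c) (M : lmodType R).

Inductive tensor_relation : {freeg (L * M)} -> Prop :=
| TensorDl x x' y :
    tensor_relation (<<(x + x', y)>> - (<<(x, y)>> + <<(x', y)>>))
| TensorDr x y y' :
    tensor_relation (<<(x, y + y')>> - (<<(x, y)>> + <<(x, y')>>))
| TensorZ (r : R) x y :
    tensor_relation (<<((r : R^c) *: x, y)>> - <<(x, r *: y)>>).

Inductive tensor_null : {freeg (L * M)} -> Prop :=
| TensorNullR u : tensor_relation u -> tensor_null u
| TensorNull0 : tensor_null 0
| TensorNullB u v : tensor_null u -> tensor_null v -> tensor_null (u - v).

Definition tensor_nullb : pred {freeg (L * M)} := fun u => `[< tensor_null u >].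

Fact tensor_null_zmod_closed : zmod_closed tensor_nullb.
Proof.
split=> [|u v /asboolP uP /asboolP vP]; apply/asboolP; first exact: TensorNull0.
exact: TensorNullB.
Qed.

HB.instance Definition _ :=
  GRing.isZmodClosed.Build _ tensor_nullb tensor_null_zmod_closed.

Definition tensor : zmodType :=
  Quotient.quot (tensor_nullb : {pred {freeg (L * M)}}).

Definition tmul (x : L) (y : M) : tensor := \pi_tensor <<(x, y)>>.

End Tensor.

Section TensorMap.

Variables (R : pzRingType) (M : lmodType R).
Variables (L K : lmodType R^c) (f : {linear L -> K}).

Definition freeg_tensor_map : {freeg (L * M)} -> {freeg (K * M)} :=
  fglift (fun p => <<(f p.1, p.2)>>).

Definition tensor_map (t : tensor L M) : tensor K M :=
  \pi_(tensor K M) (freeg_tensor_map (repr t)).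

Fact freeg_tensor_map_is_zmod_morphism : zmod_morphism freeg_tensor_map.
Proof. exact: lift_is_additive. Qed.

HB.instance Definition _ := GRing.isZmodMorphism.Build _ _ freeg_tensor_map
  freeg_tensor_map_is_zmod_morphism.

Lemma freeg_tensor_mapU p : freeg_tensor_map <<p>> = <<(f p.1, p.2)>>.
Proof. by rewrite /freeg_tensor_map liftU scale1r. Qed.

Lemma freeg_tensor_map_null u : tensor_null u -> tensor_null (freeg_tensor_map u).
Proof.
elim=> {u} [u [x x' y|x y y'|r x y]||u v _ Pu _ Pv].
- rewrite raddfB raddfD /= !freeg_tensor_mapU /= raddfD.
  exact/TensorNullR/TensorDl.
- rewrite raddfB raddfD /= !freeg_tensor_mapU /=.
  exact/TensorNullR/TensorDr.
- rewrite raddfB /= !freeg_tensor_mapU /= linearZ.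
  exact/TensorNullR/TensorZ.
- by rewrite raddf0; exact: TensorNull0.
- by rewrite raddfB; exact: TensorNullB.
Qed.

Lemma tensor_eqP (L' : lmodType R^c) (u v : {freeg (L' * M)}) :
  \pi_(tensor L' M) u = \pi_(tensor L' M) v <-> tensor_null (u - v).
Proof.
split=> [/eqP|uv]; last apply/eqP.
  by rewrite -Quotient.idealrBE => /asboolP.
by rewrite -Quotient.idealrBE; apply/asboolP.
Qed.

Lemma tensor_map_pi u :
  tensor_map (\pi_(tensor L M) u) = \pi_(tensor K M) (freeg_tensor_map u).
Proof.
apply/tensor_eqP; rewrite -raddfB; apply: freeg_tensor_map_null.
by apply/tensor_eqP; rewrite reprK.
Qed.

Lemma tensor_map_tmul x y : tensor_map (tmul x y) = tmul (f x) y.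
Proof. by rewrite tensor_map_pi freeg_tensor_mapU. Qed.

Fact tensor_map_is_zmod_morphism : zmod_morphism tensor_map.
Proof.
move=> s t; rewrite -[s]reprK -[t]reprK -raddfB !tensor_map_pi raddfB.
exact: raddfB.
Qed.

HB.instance Definition _ := GRing.isZmodMorphism.Build (tensor L M) (tensor K M)
  tensor_map tensor_map_is_zmod_morphism.

End TensorMap.

Arguments tensor_map {R} M {L K} f t.

Section Domains.

Variable R : pzRingType.
Implicit Types (M N F : lmodType R) (L K : lmodType R^c).

Definition flat F : Prop := forall L K (i : {linear L -> K}),
  injective i -> injective (tensor_map F i).

Definition finitely_presented M : Prop :=
  exists m n (q : {linear 'rV[R]_m -> 'rV[R]_n}) (p : {linear 'rV[R]_n -> M}),
    (forall y, exists v, p v = y) /\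
    (forall v, p v = 0 <-> exists u, q u = v).

Definition flat_precover F N (g : {linear F -> N}) : Prop :=
  flat F /\
  forall F', flat F' -> forall f : {linear F' -> N},
    exists h : {linear F' -> F}, g \o h =1 f.

Definition flat_precover_completing_domain M N : Prop :=
  forall (f : {linear M -> N}) F (g : {linear F -> N}),
    flat_precover g -> exists h : {linear M -> F}, g \o h =1 f.

(* The inclusion of L as a submodule of K is rendered by an injective map. *)
Definition absolutely_pure_domain M L : Prop :=
  forall K (i : {linear L -> K}), injective i -> injective (tensor_map M i).

End Domains.

(* Main.v *)
Require Import Defs.
From HB Require Import structures.
From mathcomp Require Import all_boot all_order all_algebra.
From mathcomp Require Import ring_quotient boolp classical_sets functions.
From mathcomp.multinomials Require Import freeg.

Set Implicit Arguments.
Unset Strict Implicit.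
Unset Printing Implicit Defensive.

Import Order.TTheory GRing.Theory Num.Theory.
Local Open Scope ring_scope.
Local Open Scope quotient_scope.
Local Open Scope classical_set_scope.

(* Write N^+ for the character module. As Q/Z is injective, a finite presentation
   of M identifies N^+ (x) M with Hom(M, N)^+. If g : F -> N is a flat precover, it
   is surjective, N^+ embeds into F^+, and purity of N^+ makes
   Hom(M, N)^+ -> Hom(M, F)^+ injective, so that every M -> N lifts to F.
   Conversely, if every M -> N lifts to a flat module F, it factors through some
   R^k, and N^+ (x) R^k -> K (x) R^k is visibly injective.

   The converse needs the existence of a flat precover of N. Let P be maximal among
   the pure submodules of a flat F contained in the kernel of f : F -> N. Choose
   Skolem functions for linear systems over F modulo P in such a way that right-hand
   sides in the same coset of the solvable ones get compatible solutions. If the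
   terms t in one variable satisfy f(t(a)) = f(t(b)) for all t, then
   P + {t(a) - t(b)} is again pure and killed by f, so a - b lies in P. Hence F/P
   embeds, as a set, into the functions from terms to N, and the direct sum of all
   flat modules carried by subsets of this fixed set is a flat precover. *)

(** * Injectivity of Q/Z *)

(** Zorn's lemma is applied to the sets whose union with [A0] satisfies [P]. The empty chain is then
    handled by [A0] itself, so [P] needs to be stable only under unions of nonempty chains. *)
Lemma exists_maximal_above (T : Type) (P : set (set T)) (A0 : set T) :
    P A0 ->
    (forall C : set (set T), C !=set0 -> C `<=` P -> total_on C subset ->
       P (\bigcup_(X in C) X)) ->
  exists A, [/\ P A, A0 `<=` A & forall B, P B -> A `<=` B -> B `<=` A].
Proof.
move=> PA0 PU.
have [|A [PA maxA]] := @Zorn_bigcup T [set A | P (A0 `|` A)].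
  move=> C CP Ctot /=; have [->|/set0P[A1 CA1]] := eqVneq C set0.
    by rewrite bigcup_set0 setU0.
  rewrite (_ : _ `|` _ = \bigcup_(X in [set A0 `|` X | X in C]) X).
    apply: PU; first by exists (A0 `|` A1), A1.
      by move=> _ [X CX <-]; exact: CP.
    move=> _ _ [X CX <-] [Y CY <-].
    by have [XY|YX] := Ctot _ _ CX CY; [left|right]; exact: setUS.
  apply/seteqP; split=> [x [A0x|[X CX Xx]]|x [_ [X CX <-]] [A0x|Xx]].
  - by exists (A0 `|` A1); [exists A1|left].
  - by exists (A0 `|` X); [exists X|right].
  - by left.
  - by right; exists X.
exists (A0 `|` A); split=> //.
move=> B PB AB x Bx; apply: contrapT => nAx.
apply: (maxA B).
  split; first by move=> y Ay; apply: AB; right.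
  by move=> BA; apply: nAx; right; exact: BA.
by rewrite /= setUidr // => y A0y; apply: AB; left.
Qed.

Section Subgroup.
Variable V : zmodType.

Definition subgroup (A : set V) : Prop :=
  A 0 /\ forall x y, A x -> A y -> A (x - y).

Variables (A : set V) (sA : subgroup A).

Lemma subgroupN x : A x -> A (- x).
Proof. by move=> Ax; rewrite -sub0r; apply: sA.2 => //; exact: sA.1. Qed.

Lemma subgroupD x y : A x -> A y -> A (x + y).
Proof. by move=> Ax Ay; rewrite -[y]opprK; apply: sA.2 => //; exact: subgroupN. Qed.

Lemma subgroupMz x (k : int) : A x -> A (x *~ k).
Proof.
move=> Ax; have An n : A (x *+ n).
  elim: n => [|n IHn]; first by rewrite mulr0n; exact: sA.1.
  by rewrite mulrS; exact: subgroupD.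
by case: k => n; rewrite ?NegzE ?mulrNz; [exact: An|apply/subgroupN/An].
Qed.

(** The integers [k] with [v *~ k] in [A] form an ideal of Z, and [d] is its nonnegative generator.
    The value [d = 0] encodes infinite order modulo [A], as 0 divides only 0. *)
Lemma subgroup_order (v : V) :
  exists d : nat, forall k : int, A (v *~ k) <-> (d %| k)%Z.
Proof.
have [[n /andP[n0 /asboolP An]]|noA] :=
  pselect (exists n : nat, (0 < n)%N && `[< A (v *+ n) >]).
- have ex : exists n : nat, (0 < n)%N && `[< A (v *+ n) >].
    by exists n; rewrite n0; apply/asboolP.
  case: (ex_minnP ex) => d /andP[d0 /asboolP Ad] mind; exists d => k.
  have vdq q : A (v *~ (q * d%:Z)) by rewrite mulrC mulrzA; exact: subgroupMz.
  split=> [Ak|/dvdzP[q ->]]; last exact: vdq.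
  have : A (v *~ (k %% d)%Z).
    by rewrite /modz mulrzBr; exact: sA.2.
  have : (0 <= (k %% d)%Z) by rewrite modz_ge0 // -lt0n.
  have : ((k %% d)%Z < d) by rewrite ltz_pmod.
  rewrite dvdzE; case E: (k %% d)%Z => [r|//] rd _ Ar.
  have [r0|r0] := posnP r.
    by apply/dvdz_mod0P; rewrite E r0.
  have := mind r; rewrite r0 asboolT // => /(_ isT).
  by rewrite leqNgt -ltz_nat rd.
- exists 0%N => k; split=> [Ak|]; last first.
    by rewrite dvd0z => /eqP ->; rewrite mulr0z; exact: sA.1.
  rewrite dvd0z; apply: contrapT => /negP k0; apply: noA; exists `|k|%N.
  rewrite absz_gt0 k0; apply/asboolP; case: k k0 Ak => n _ //.
  by rewrite NegzE mulrNz => /subgroupN; rewrite opprK abszN; exact.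
Qed.

End Subgroup.

Lemma rat_mod_int_pi_eq0 (q : rat) :
  (\pi_rat_mod_int q = 0 :> rat_mod_int) <-> q \is a Num.int.
Proof.
rewrite -[0](raddf0 (\pi_rat_mod_int)); split=> [/eqP|qI].
  by rewrite -Quotient.idealrBE subr0.
by apply/eqP; rewrite -Quotient.idealrBE subr0.
Qed.

Lemma rat_mod_int_divisible (y : rat_mod_int) (n : nat) :
  (0 < n)%N -> exists z, z *+ n = y.
Proof.
move=> n0; exists (\pi_rat_mod_int (repr y / n%:R)).
rewrite -raddfMn -[_ *+ n]mulr_natr /= divfK ?reprK //.
by rewrite pnatr_eq0 -lt0n.
Qed.

(** The class of 1/d works, except for [d = 0], where only [k = 0] is constrained and the class of
    1/2 serves. *)
Lemma rat_mod_int_order (d : nat) : d != 1%N ->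
  exists2 c : rat_mod_int, c != 0 & forall k : int, (d %| k)%Z -> c *~ k = 0.
Proof.
move=> d1; pose e := if d == 0%N then 2%N else d.
have e1 : (1 < e)%N by rewrite /e; case: (d) d1 => [|[|]].
have de : (e %| d)%N by rewrite /e; case: eqP => [->|].
exists (\pi_rat_mod_int (e%:R^-1)).
  apply/eqP => /rat_mod_int_pi_eq0 /intrP[m em].
  have : (0 < (e%:R^-1 : rat) < 1).
    by rewrite invr_gt0 ltr0n invf_lt1 ?ltr0n ?ltr1n ?e1 ltnW.
  rewrite em ltr0z -[1]/(1%:~R) ltr_int => /andP[m0 m1].
  by case: m m0 m1 {em} => [[|[]]|].
move=> k dk; rewrite -raddfMz; apply/rat_mod_int_pi_eq0.
have : (e %| k)%Z by apply: dvdz_trans dk; rewrite dvdzE.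
move=> /dvdzP[q ->]; rewrite -mulrzl intrM -mulrA divff ?mulr1 ?intr_int //.
by rewrite intr_eq0; case: (e) e1.
Qed.

Section DivisibleExtension.
Variables (W D : zmodType).
Hypothesis D_div : forall (y : D) (n : nat), (0 < n)%N -> exists z, z *+ n = y.

Let graph_like (G : set (W * D)) :=
  subgroup G /\ forall y, G (0, y) -> y = 0.

(** Baer's argument. A partial homomorphism is represented by its graph, so that extension becomes
    inclusion and Zorn's lemma applies; divisibility lets any [w] be adjoined to the domain, so a
    maximal graph is total. *)
Lemma divisible_extension_graph (G0 : set (W * D)) : graph_like G0 ->
  exists psi : {additive W -> D}, forall p, G0 p -> psi p.1 = p.2.
Proof.
move=> gG0.
have [|G [[sG uG] G0G maxG]] := @exists_maximal_above _ graph_like G0 gG0.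
  move=> C [X0 CX0] Cg Ctot; split; last first.
    by move=> y [X CX]; exact: (Cg _ CX).2.
  split; first by exists X0 => //; exact: (Cg _ CX0).1.1.
  move=> x y [X CX Xx] [Y CY Yy]; have [XY|YX] := Ctot _ _ CX CY.
    by exists Y => //; apply: (Cg _ CY).1.2 => //; exact: XY.
  by exists X => //; apply: (Cg _ CX).1.2 => //; exact: YX.
have total w : exists y, G (w, y).
  pose A := [set x | exists y, G (x, y)].
  have sA : subgroup A.
    split; first by exists 0; exact: sG.1.
    by move=> x x' [y Gy] [y' Gy']; exists (y - y'); exact: sG.2 Gy Gy'.
  have [d Ad] := subgroup_order sA w.
  (* The image [z] of [w] must agree with [G] on the multiples of [w] already in the domain: it is a
     [d]-th part of the value at [w *~ d], or 0 if [w] has infinite order modulo the domain. *)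
  have [z Gz] : exists z : D, forall k, A (w *~ k) -> G (w *~ k, z *~ k).
    have [d0|d0] := posnP d.
      exists 0 => k /Ad; rewrite d0 dvd0z => /eqP ->; rewrite !mulr0z.
      exact: sG.1.
    have [y Gy] : A (w *~ d) by apply/Ad.
    have [z zy] := D_div y d0; exists z => k /Ad /dvdzP[q ->].
    rewrite [q * _]mulrC !mulrzA -[z *~ d]/(z *+ d) zy.
    have := subgroupMz sG q Gy.
    by rewrite [X in G X]surjective_pairing (raddfMz fst) (raddfMz snd).
  pose G1 := [set p | exists g (k : int), G g /\ p = (g.1 + w *~ k, g.2 + z *~ k)].
  have GG1 : G `<=` G1.
    by move=> [x y] Gxy; exists (x, y), 0; rewrite !mulr0z !addr0.
  exists z; apply: (maxG G1) => //; last first.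
    exists 0, 1; split; first exact: sG.1.
    by rewrite /= !mulr1z !add0r.
  split.
    split; first by apply/GG1; exact: sG.1.
    move=> _ _ [g [k [Gg ->]]] [g' [k' [Gg' ->]]].
    exists (g - g'), (k - k'); split; first exact: sG.2.
    by rewrite /= !mulrzBr; congr pair; rewrite /= opprD addrACA.
  move=> y [[x x'] [k [Gx [e ->]]]] /=.
  have xE : x = - (w *~ k) by apply/eqP; rewrite -addr_eq0 -e.
  have Ak : A (w *~ k).
    have : G (- x, - x') := subgroupN sG Gx.
    by rewrite xE opprK; exists (- x').
  apply: uG.
  have : G (x + w *~ k, x' + z *~ k) := subgroupD sG Gx (Gz _ Ak).
  by rewrite xE addNr.
have [psi Gpsi] := choice total.
have psiP x y : G (x, y) -> psi x = y.
  move=> Gxy; apply/eqP; rewrite -subr_eq0; apply/eqP/uG.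
  have : G (x - x, psi x - y) := sG.2 _ _ (Gpsi x) Gxy.
  by rewrite subrr.
have psiB : zmod_morphism psi.
  by move=> x y; apply: psiP; have := sG.2 _ _ (Gpsi x) (Gpsi y).
pose psiM := GRing.isZmodMorphism.Build _ _ psi psiB.
exists (HB.pack_for {additive W -> D} psi psiM) => -[x y] /G0G; exact: psiP.
Qed.

End DivisibleExtension.

Lemma additive_pack (U V : zmodType) (f : U -> V) :
  zmod_morphism f -> exists g : {additive U -> V}, g =1 f.
Proof.
move=> fB; pose fM := GRing.isZmodMorphism.Build _ _ f fB.
by exists (HB.pack_for {additive U -> V} f fM).
Qed.

Lemma linear_pack (R : pzRingType) (U V : lmodType R) (f : U -> V) :
  linear f -> exists g : {linear U -> V}, g =1 f.
Proof.
move=> fL; pose fM := GRing.isLinear.Build _ _ _ _ f fL.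
by exists (HB.pack_for {linear U -> V} f fM).
Qed.

(** The pairs [(Q v, phi v)] form the graph of a homomorphism on the image of [Q], which
    divisibility extends to all of [W]. *)
Lemma divisible_factor (V W D : zmodType) (Q : {additive V -> W})
    (phi : {additive V -> D}) :
    (forall (y : D) (n : nat), (0 < n)%N -> exists z, z *+ n = y) ->
    (forall v, Q v = 0 -> phi v = 0) ->
  exists psi : {additive W -> D}, forall v, psi (Q v) = phi v.
Proof.
move=> D_div Qphi.
have [|psi psiP] := @divisible_extension_graph W D D_div
    [set p | exists v, p = (Q v, phi v)].
  split; last by move=> y [v [/esym /Qphi <- ->]].
  split; first by exists 0; rewrite !raddf0.
  by move=> _ _ [v ->] [w ->]; exists (v - w); rewrite !raddfB.
by exists psi => v; apply: (psiP (Q v, phi v)); exists v.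
Qed.

(** On the subgroup generated by [A] and [v], send [a + v *~ k] to [c *~ k]. This is well defined
    because [c] is killed by the order of [v] modulo [A]. *)
Lemma rat_mod_int_separates (V : zmodType) (A : set V) (v : V) :
    subgroup A -> ~ A v ->
  exists2 chi : {additive V -> rat_mod_int},
    (forall a, A a -> chi a = 0) & chi v != 0.
Proof.
move=> sA nAv; have [d Ad] := subgroup_order sA v.
have [|c c0 dc] := @rat_mod_int_order d.
  by apply: contra_notN nAv => /eqP d1; have [_] := Ad 1; rewrite d1; exact.
have [|chi chiP] := @divisible_extension_graph V _ rat_mod_int_divisible
    [set p | exists2 k : int, A (p.1 - v *~ k) & p.2 = c *~ k].
  split.
    split; first by exists 0; rewrite /= ?mulr0z ?subr0 //; exact: sA.1.
    move=> [x y] [x' y'] [k /= Ax ->] [k' /= Ax' ->]; exists (k - k') => /=.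
      rewrite mulrzBr opprB [_ *~ k' - _]addrC addrACA [- x' + _]addrC.
      by rewrite -[_ *~ k' - _]opprB; exact: sA.2.
    by rewrite mulrzBr.
  move=> y [k /=]; rewrite sub0r => /(subgroupN sA); rewrite opprK => /Ad kd ->.
  exact: dc.
exists chi => [a Aa|].
  by apply: (chiP (a, 0)); exists 0; rewrite /= ?mulr0z ?subr0.
rewrite (chiP (v, c)) //; exists 1; rewrite /= ?mulr1z // subrr.
exact: sA.1.
Qed.

(** * Tensor products and quotients *)

Section FreeAbelian.
Variable K : choiceType.

Lemma freeg_lift (D : zmodType) (f : K -> D) :
  exists phi : {additive {freeg K} -> D}, forall k, phi <<k>> = f k.
Proof.
have [phi phiE] := @additive_pack _ _ (fglift (f : K -> zmodule D))
  (lift_is_additive _).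
by exists phi => k; rewrite phiE liftU scale1r.
Qed.

Lemma freeg_ind_generator (P : {freeg K} -> Prop) :
    P 0 -> (forall k, P <<k>>) -> (forall u v, P u -> P v -> P (u - v)) ->
  forall u, P u.
Proof.
move=> P0 PU PB.
have sP : subgroup [set u | P u] by split.
elim/freeg_ind_dom0 => // k x u _ _ Pu.
apply: (subgroupD sP) => //; have := subgroupMz sP k (PU x).
by rewrite freegU_mulz intz.
Qed.

End FreeAbelian.

Section TensorTheory.
Variables (R : pzRingType) (L : lmodType R^c) (M : lmodType R).

Lemma tmulDl (x x' : L) (y : M) : tmul (x + x') y = tmul x y + tmul x' y.
Proof.
rewrite /tmul -raddfD; apply/tensor_eqP.
exact/TensorNullR/TensorDl.
Qed.

Lemma tmulDr (x : L) (y y' : M) : tmul x (y + y') = tmul x y + tmul x y'.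
Proof.
rewrite /tmul -raddfD; apply/tensor_eqP.
exact/TensorNullR/TensorDr.
Qed.

Lemma tmulZ (r : R) (x : L) (y : M) : tmul ((r : R^c) *: x) y = tmul x (r *: y).
Proof. by apply/tensor_eqP; exact/TensorNullR/TensorZ. Qed.

Lemma tmul0l (y : M) : tmul (0 : L) y = 0.
Proof. by apply: (addIr (tmul (0 : L) y)); rewrite -tmulDl !add0r. Qed.

Lemma tmul0r (x : L) : tmul x (0 : M) = 0.
Proof. by apply: (addIr (tmul x 0)); rewrite -tmulDr !add0r. Qed.

Lemma tmul_suml (I : Type) (s : seq I) (x : I -> L) (y : M) :
  tmul (\sum_(i <- s) x i) y = \sum_(i <- s) tmul (x i) y.
Proof. exact: (big_morph _ (fun a b => tmulDl a b y) (tmul0l y)). Qed.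

Lemma tmul_sumr (I : Type) (s : seq I) (x : L) (y : I -> M) :
  tmul x (\sum_(i <- s) y i) = \sum_(i <- s) tmul x (y i).
Proof. exact: (big_morph _ (fun a b => tmulDr x a b) (tmul0r x)). Qed.

Lemma tensor_ind (P : tensor L M -> Prop) :
    P 0 -> (forall x y, P (tmul x y)) -> (forall s t, P s -> P t -> P (s - t)) ->
  forall t, P t.
Proof.
move=> P0 PU PB t; rewrite -[t]reprK; move: (repr t).
apply: freeg_ind_generator; first by rewrite raddf0.
- by move=> [x y]; exact: PU.
- by move=> u v Pu Pv; rewrite raddfB; exact: PB.
Qed.

Lemma tensor_additive_ext (D : zmodType) (f g : {additive tensor L M -> D}) :
  (forall x y, f (tmul x y) = g (tmul x y)) -> f =1 g.
Proof.
move=> fg; apply: tensor_ind => //; first by rewrite !raddf0.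
by move=> s t fs ft; rewrite !raddfB fs ft.
Qed.

(** The additive extension of [beta] to the free group kills the relations, hence can be evaluated
    on representatives. *)
Lemma tensor_lift (D : zmodType) (beta : L -> M -> D) :
    (forall x x' y, beta (x + x') y = beta x y + beta x' y) ->
    (forall x y y', beta x (y + y') = beta x y + beta x y') ->
    (forall (r : R) x y, beta ((r : R^c) *: x) y = beta x (r *: y)) ->
  exists phi : {additive tensor L M -> D}, forall x y, phi (tmul x y) = beta x y.
Proof.
move=> bDl bDr bZ; have [phi phiU] := freeg_lift (fun p => beta p.1 p.2).
have phi0 u : tensor_null u -> phi u = 0.
  elim=> {u} [u [x x' y|x y y'|r x y]||u v _ Pu _ Pv]; rewrite ?raddf0 //.
  - by rewrite raddfB raddfD !phiU /= bDl subrr.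
  - by rewrite raddfB raddfD !phiU /= bDr subrr.
  - by rewrite raddfB !phiU /= bZ subrr.
  - by rewrite raddfB Pu Pv subrr.
have phiE u : phi (repr (\pi_(tensor L M) u)) = phi u.
  apply/eqP; rewrite -subr_eq0 -raddfB; apply/eqP/phi0/tensor_eqP.
  by rewrite reprK.
have [|psi psiE] := @additive_pack _ _ (fun t : tensor L M => phi (repr t)).
  by move=> s t; rewrite -[s]reprK -[t]reprK -raddfB !phiE raddfB.
by exists psi => x y; rewrite psiE phiE phiU.
Qed.

End TensorTheory.

(** A scalar action bundled with its laws. The alias [scaled] carries it as an index, so that a
    group built inside a proof can be given a module structure. *)
Record scaling (R : pzRingType) (Q : zmodType) := Scaling {
  scaling_op : R -> Q -> Q;
  scalingA : forall a b q,
    scaling_op a (scaling_op b q) = scaling_op (a * b) q;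
  scaling1 : left_id 1 scaling_op;
  scalingDr : right_distributive scaling_op +%R;
  scalingDl : forall q, {morph scaling_op^~ q : a b / a + b} }.

Definition scaled (R : pzRingType) (Q : zmodType) (sc : scaling R Q) : Type := Q.

HB.instance Definition _ (R : pzRingType) (Q : zmodType) (sc : scaling R Q) :=
  GRing.Zmodule.on (scaled sc).
HB.instance Definition _ (R : pzRingType) (Q : zmodType) (sc : scaling R Q) :=
  GRing.Zmodule_isLmodule.Build R (scaled sc) (@scalingA R Q sc)
    (@scaling1 R Q sc) (@scalingDr R Q sc) (@scalingDl R Q sc).

Section QuotientModule.
Variables (R : pzRingType) (V : lmodType R).

Definition submodule (A : set V) : Prop :=
  A 0 /\ forall (r : R) x y, A x -> A y -> A (r *: x + y).

Lemma submodule_subgroup A : submodule A -> subgroup A.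
Proof.
case=> A0 AL; split=> // x y Ax Ay.
by rewrite addrC -scaleN1r; exact: AL.
Qed.

Lemma submoduleZ A (r : R) x : submodule A -> A x -> A (r *: x).
Proof. by move=> [A0 AL] Ax; rewrite -[_ *: _]addr0; exact: AL. Qed.

Lemma exists_quotient_module (A : set V) : submodule A ->
  exists (Q : lmodType R) (pi : {linear V -> Q}),
    (forall q, exists x, pi x = q) /\ (forall x, pi x = 0 <-> A x).
Proof.
move=> sA; have gA := submodule_subgroup sA.
pose Ab : pred V := fun x => `[< A x >].
have AbP : zmod_closed Ab.
  split=> [|x y /asboolP Ax /asboolP Ay]; apply/asboolP; first exact: sA.1.
  exact: gA.2.
pose I := HB.pack_for (zmodClosed V) Ab (GRing.isZmodClosed.Build V Ab AbP).
pose Q : zmodType := Quotient.quot I.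
have piE x y : \pi_Q x = \pi_Q y <-> A (x - y).
  split=> [/eqP|Axy]; last apply/eqP.
    by rewrite -Quotient.idealrBE => /asboolP.
  by rewrite -Quotient.idealrBE; apply/asboolP.
pose sc (r : R) (q : Q) : Q := \pi_Q (r *: repr q).
have scE r x : sc r (\pi_Q x) = \pi_Q (r *: x).
  by apply/piE; rewrite -scalerBr; apply: submoduleZ => //; apply/piE; rewrite reprK.
have piS (q : Q) : exists x, q = \pi_Q x by exists (repr q); rewrite reprK.
have scA a b q : sc a (sc b q) = sc (a * b) q.
  by have [x ->] := piS q; rewrite !scE scalerA.
have sc1 : left_id 1 sc by move=> q; have [x ->] := piS q; rewrite scE scale1r.
have scDr : right_distributive sc +%R.
  move=> a p q; have [x ->] := piS p; have [y ->] := piS q.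
  by rewrite -raddfD !scE scalerDr raddfD.
have scDl q : {morph sc^~ q : a b / a + b}.
  by move=> a b; have [x ->] := piS q; rewrite !scE scalerDl raddfD.
pose Qm : lmodType R := scaled (Scaling scA sc1 scDr scDl).
have [|pi piL] := @linear_pack R V Qm (\pi_Q : V -> Qm).
  by move=> r x y; rewrite -[LHS]/(\pi_Q (r *: x + y)) raddfD; congr +%R; exact/esym/scE.
exists Qm, pi; split=> [q|x].
  by have [x qx] := piS q; exists x; rewrite piL qx.
rewrite piL -[x in A x]subr0 -piE; split=> [->|->]; last exact: raddf0.
exact/esym/raddf0.
Qed.
End QuotientModule.

(** * Finitely presented modules and characters *)

Section FinitePresentation.
Variables (R : pzRingType) (M : lmodType R).

(** The rows of [A] are the relations between the generators [x0]. That they generate all relations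
    is expressed by the universal property of the cokernel: the maps from [M] to [F] are the
    solutions in [F] of the homogeneous system. *)
Definition presents (m n : nat) (A : 'I_m -> 'I_n -> R) (x0 : 'I_n -> M) : Prop :=
  [/\ forall y, exists c : 'I_n -> R, y = \sum_j c j *: x0 j,
      forall i, \sum_j A i j *: x0 j = 0 &
      forall (F : lmodType R) (x : 'I_n -> F),
        (forall i, \sum_j A i j *: x j = 0) ->
        exists h : {linear M -> F}, forall j, h (x0 j) = x j].

Lemma finitely_presentedP : finitely_presented M ->
  exists m n (A : 'I_m -> 'I_n -> R) x0, presents A x0.
Proof.
move=> [m [n [q [p [p_surj p_ker]]]]].
have rowE k (v : 'rV[R]_k) : v = \sum_j v ord0 j *: delta_mx ord0 j.
  exact: row_sum_delta.
have pE v : p v = \sum_j v ord0 j *: p (delta_mx ord0 j).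
  rewrite {1}[v]rowE linear_sum; apply: eq_bigr => j _; exact: linearZ.
exists m, n, (fun i j => q (delta_mx ord0 i) ord0 j), (fun j => p (delta_mx ord0 j)).
split=> [y|i|F x xA].
- by have [v <-] := p_surj y; exists (v ord0); rewrite -pE.
- by rewrite -pE; apply/p_ker; exists (delta_mx ord0 i).
(* [s] is only a set-theoretic section of [p], but a linear map that kills the kernel of [p] becomes
   linear on [M] once composed with [s]. *)
have [s sP] := choice p_surj.
pose e (v : 'rV[R]_n) := \sum_j v ord0 j *: x j.
have eL : linear e.
  move=> r v w; rewrite /e scaler_sumr -big_split; apply: eq_bigr => j _ /=.
  by rewrite !mxE scalerDl scalerA.
have [e' e'E] := linear_pack eL.
have e_ker v : p v = 0 -> e' v = 0.
  move=> /p_ker[u <-]; rewrite [u]rowE !linear_sum big1 // => i _.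
  by rewrite !linearZ e'E [e _]xA /= scaler0.
have e_eq v w : p v = p w -> e' v = e' w.
  move=> pvw; apply/eqP; rewrite -subr_eq0 -linearB; apply/eqP/e_ker.
  by rewrite linearB pvw subrr.
have [|h hE] := @linear_pack R M F (fun y => e' (s y)).
  by move=> r y z; rewrite -linearP; apply: e_eq; rewrite linearP !sP.
exists h => j; rewrite hE (e_eq _ (delta_mx ord0 j)) ?sP // e'E /e.
rewrite (bigD1 j) //= big1 => [|k kj].
  by rewrite mxE !eqxx scale1r addr0.
by rewrite mxE (negbTE kj) scale0r.
Qed.

Lemma tensor_generators (L : lmodType R^c) n (x0 : 'I_n -> M) :
    (forall y, exists c : 'I_n -> R, y = \sum_j c j *: x0 j) ->
  forall t : tensor L M, exists l : 'I_n -> L, t = \sum_j tmul (l j) (x0 j).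
Proof.
move=> gen; apply: tensor_ind.
- by exists (fun=> 0); rewrite big1 // => j _; rewrite tmul0l.
- move=> x y; have [c ->] := gen y; exists (fun j => (c j : R^c) *: x).
  by rewrite tmul_sumr; apply: eq_bigr => j _; rewrite tmulZ.
- move=> _ _ [l ->] [l' ->]; exists (fun j => l j - l' j).
  rewrite -sumrB; apply: eq_bigr => j _; apply/eqP.
  by rewrite subr_eq -tmulDl subrK.
Qed.

End FinitePresentation.

Section Delta.
Variables (m : nat) (N : zmodType).

Definition single (i : 'I_m) (y : N) : 'I_m -> N := fun k => if k == i then y else 0.

Lemma single_is_additive i : zmod_morphism (single i).
Proof.
move=> x y; apply/funext => k; rewrite /single.
rewrite -[RHS]/((if k == i then x else 0) - (if k == i then y else 0)).
by case: eqP; rewrite ?subrr.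
Qed.

HB.instance Definition _ i := GRing.isZmodMorphism.Build _ _ (single i)
  (single_is_additive i).

Lemma sum_single (x : 'I_m -> N) : \sum_i single i (x i) = x.
Proof.
apply/funext => k; rewrite fct_sumE (bigD1 k) //= big1 => [|i ik].
  by rewrite /single eqxx addr0.
by rewrite /single eq_sym (negbTE ik).
Qed.

End Delta.

Section CharacterComp.
Variables (R : pzRingType) (F N : lmodType R) (g : {linear F -> N}).

Fact character_comp_subproof (c : character N) : is_character (c \o g).
Proof. by apply/asboolP => x y; rewrite /= !raddfB. Qed.

Definition character_comp (c : character N) : character F :=
  Character (character_comp_subproof c).

Fact character_comp_is_linear : linear character_comp.
Proof.
move=> r c d; apply/val_inj/funext => x.
rewrite -[LHS]/(c ((r : R) *: g x) + d (g x)) -[RHS]/(c (g ((r : R) *: x)) + d (g x)).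
by rewrite linearZ.
Qed.

HB.instance Definition _ := GRing.isLinear.Build R^c (character N) (character F)
  _ character_comp character_comp_is_linear.

End CharacterComp.

Section CharacterTensor.
Variables (R : pzRingType) (M : lmodType R).

Lemma character_pack (N : lmodType R) (g : {additive N -> rat_mod_int}) :
  exists phi : character N, phi =1 g.
Proof.
have gP : is_character g by apply/asboolP; exact: raddfB.
by exists (Character gP).
Qed.

Lemma character_sumE (N : lmodType R) (I : Type) (s : seq I)
    (phi : I -> character N) y :
  (\sum_(i <- s) phi i) y = \sum_(i <- s) phi i y.
Proof. exact: (big_morph (fun c : character N => c y)). Qed.

(** This is the component at [f] of the natural map from N^+ (x) M to Hom(M, N)^+. *)
Lemma character_eval_exists (N : lmodType R) (f : {linear M -> N}) :
  exists ev : {additive tensor (character N) M -> rat_mod_int},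
    forall phi y, ev (tmul phi y) = phi (f y).
Proof.
apply: (@tensor_lift _ _ _ _ (fun (phi : character N) y => phi (f y))) => //.
- by move=> phi y y'; rewrite !raddfD.
- by move=> r phi y; rewrite linearZ.
Qed.

Definition character_eval (N : lmodType R) (f : {linear M -> N}) :=
  projT1 (cid (character_eval_exists f)).

Lemma character_evalE (N : lmodType R) (f : {linear M -> N}) phi y :
  character_eval f (tmul phi y) = phi (f y).
Proof. exact: (projT2 (cid (character_eval_exists f))). Qed.

Hypothesis M_fp : finitely_presented M.

(** Write t as the sum of the phi_j (x) x0_j. The character [Phi] of N^n with components phi_j
    vanishes on the kernel of [A], which is Hom(M, N), so it factors through [A] by some [psi] on
    N^m. Hence phi_j is the sum of the psi_i A_ij, and moving [A] across the tensor sign makes the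
    relations of [M] appear. *)
Lemma character_eval_inj (N : lmodType R) (t : tensor (character N) M) :
  (forall f : {linear M -> N}, character_eval f t = 0) -> t = 0.
Proof.
move=> t0; have [m [n [A [x0 [gen rel lift]]]]] := finitely_presentedP M_fp.
have [phi tE] := tensor_generators gen t.
have [|Q QE] := @additive_pack ('I_n -> N) ('I_m -> N)
    (fun x i => \sum_j A i j *: x j).
  move=> x y; apply/funext => i.
  rewrite -[RHS]/(\sum_j A i j *: x j - \sum_j A i j *: y j) -sumrB.
  by apply: eq_bigr => j _; rewrite -scalerBr.
have [|Phi PhiE] := @additive_pack ('I_n -> N) rat_mod_int
    (fun x => \sum_j phi j (x j)).
  by move=> x y; rewrite -sumrB; apply: eq_bigr => j _; rewrite -raddfB.
have [|psi psiE] := divisible_factor (Q := Q) (phi := Phi) rat_mod_int_divisible.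
  move=> x; rewrite QE => Qx0; have [|h hE] := lift _ x.
    by move=> i; exact: (congr1 (fun u => u i) Qx0).
  rewrite PhiE -[RHS](t0 h) tE raddf_sum; apply: eq_bigr => j _.
  by rewrite character_evalE hE.
have [psi_ psi_E] := choice (fun i => character_pack (psi \o single i)).
have phiE j : phi j = \sum_i (A i j : R^c) *: psi_ i.
  apply/val_inj/funext => y; rewrite /= character_sumE.
  transitivity (Phi (single j y)).
    rewrite PhiE (bigD1 j) //= big1 => [|k kj]; last first.
      by rewrite /single (negbTE kj) raddf0.
    by rewrite /single eqxx addr0.
  rewrite -psiE -[Q _]sum_single raddf_sum; apply: eq_bigr => i _.
  rewrite -[RHS]/(psi_ i (A i j *: y)) psi_E /= QE (bigD1 j) //= big1 => [|k kj].
    by rewrite /single eqxx addr0.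
  by rewrite /single (negbTE kj) scaler0.
rewrite tE; under eq_bigr do rewrite phiE tmul_suml.
rewrite exchange_big big1 // => i _.
by under eq_bigr do rewrite tmulZ; rewrite -tmul_sumr rel tmul0r.
Qed.

(** If [f] did not lift, some character [chi] of N^n would vanish on the tuples of all liftable maps
    but not on that of [f]. The components of [chi] define a tensor [t] whose image in F^+ (x) M
    pairs to 0 with every [h : M -> F], so that image is 0; purity forces [t = 0], against the
    choice of [chi]. *)
Lemma lifts_of_absolutely_pure (N F : lmodType R) (g : {linear F -> N}) :
    (forall y, exists x, g x = y) -> absolutely_pure_domain M (character N) ->
  forall f : {linear M -> N}, exists h : {linear M -> F}, g \o h =1 f.
Proof.
move=> g_surj pureN f; apply: contrapT => nolift.
have [m [n [A [x0 [gen rel lift]]]]] := finitely_presentedP M_fp.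
pose I := [set x : 'I_n -> N | exists h : {linear M -> F}, x = (fun j => g (h (x0 j)))].
have sI : subgroup I.
  split; first by exists \0; apply/funext => j; rewrite raddf0.
  move=> _ _ [h ->] [h' ->]; exists (h \- h'); apply/funext => j.
  by rewrite /= raddfB.
have nIf : ~ I (fun j => f (x0 j)).
  move=> [h fh]; apply: nolift; exists h => y /=.
  have [c ->] := gen y; rewrite !linear_sum; apply: eq_bigr => j _.
  by rewrite !linearZ /= -(congr1 (fun u => u j) fh).
have [chi chiI chif] := rat_mod_int_separates sI nIf.
have [phi phiE] := choice (fun j => character_pack (chi \o single j)).
pose t := \sum_j tmul (phi j) (x0 j).
have evt (k : {linear M -> N}) : character_eval k t = chi (fun j => k (x0 j)).
  rewrite raddf_sum -[in RHS](sum_single (fun j => k (x0 j))) raddf_sum.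
  by apply: eq_bigr => j _; rewrite character_evalE phiE.
have g_inj : injective (character_comp g).
  move=> c d cd; apply/val_inj/funext => y; have [x <-] := g_surj y.
  exact: (congr1 (fun e : character F => e x) cd).
have t0 : t = 0.
  apply: (pureN _ _ g_inj); rewrite raddf0; apply: character_eval_inj => h.
  rewrite -(chiI (fun j => g (h (x0 j)))); last by exists h.
  rewrite -[RHS](evt (g \o h)) !raddf_sum; apply: eq_bigr => j _.
  by rewrite /= tensor_map_tmul !character_evalE.
by move: chif; rewrite -evt t0 raddf0 eqxx.
Qed.

(** The hypothesis says that every map to [N] factors through a finite free module. Each form [u j]
    induces a map from L (x) M to L natural in L, so an injective [i] detects its values, and the
    evaluation at [f] depends on these values only. *)
Lemma absolutely_pure_of_factor (N : lmodType R) :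
    (forall f : {linear M -> N}, exists (K : finType)
       (u : K -> {linear M -> R^o}) (v : K -> N),
       forall y, f y = \sum_k (u k y : R) *: v k) ->
  absolutely_pure_domain M (character N).
Proof.
move=> fact K i i_inj; apply: raddf_inj => t it0.
apply: character_eval_inj => f; have [J [u [v fE]]] := fact f.
(* This is L (x) [u j] followed by the identification of L (x) R with L. *)
have comp (L : lmodType R^c) j : exists c : {additive tensor L M -> L},
    forall l y, c (tmul l y) = (u j y : R^c) *: l.
  apply: tensor_lift => [x x' y|x y y'|r x y]; first exact: scalerDr.
    by rewrite raddfD scalerDl.
  by rewrite scalerA linearZ.
have c0 j (c : {additive tensor (character N) M -> character N}) :
    (forall l y, c (tmul l y) = (u j y : R^c) *: l) -> c t = 0.
  move=> cE; have [c' c'E] := comp K j; apply: i_inj.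
  rewrite raddf0 -(raddf0 c') -it0.
  apply: (@tensor_additive_ext _ _ _ _ (i \o c) (c' \o tensor_map M i)) => l y /=.
  by rewrite tensor_map_tmul cE c'E linearZ.
have [c cE] := choice (comp (character N)).
transitivity (\sum_j c j t (v j)); last by rewrite big1 // => j _; rewrite (c0 j).
move: t {it0 c0}; apply: tensor_ind.
- by rewrite raddf0 big1 // => j _; rewrite raddf0.
- move=> phi y; rewrite character_evalE fE raddf_sum; apply: eq_bigr => j _.
  by rewrite cE.
- move=> s t Ps Pt; rewrite raddfB Ps Pt -sumrB; apply: eq_bigr => j _.
  by rewrite raddfB.
Qed.

End CharacterTensor.

(** * The equational criterion of flatness *)

Section EquationalFlatness.
Variables (R : pzRingType) (F : lmodType R).

(** A solution is trivial when it comes from relations over [R] alone. The index [K] is an arbitrary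
    finite type, so that the sum of two solutions can be indexed by a disjoint union. *)
Definition trivial_solution m n (A : 'I_m -> 'I_n -> R) (x : 'I_n -> F) : Prop :=
  exists (K : finType) (B : 'I_n -> K -> R) (y : K -> F),
    (forall j, x j = \sum_k B j k *: y k) /\
    (forall i k, \sum_j A i j * B j k = 0).

Definition equationally_flat : Prop :=
  forall m n (A : 'I_m -> 'I_n -> R) (x : 'I_n -> F),
    (forall i, \sum_j A i j *: x j = 0) -> trivial_solution A x.

Lemma trivial_solution_subgroup m n (A : 'I_m -> 'I_n -> R) :
  subgroup (trivial_solution A).
Proof.
split.
  exists void, (fun _ => of_void _), (of_void _); split=> [j|i []].
  by rewrite big1 // => -[].
move=> x x' [K [B [y [xE AB]]]] [K' [B' [y' [xE' AB']]]].
exists (K + K')%type,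
  (fun j k => match k with inl k => B j k | inr k => - B' j k end),
  (fun k => match k with inl k => y k | inr k => y' k end).
split=> [j|i [k|k]] //.
  rewrite big_sumType /= -xE -[LHS]/(x j - x' j); congr +%R.
  by rewrite xE' -sumrN; apply: eq_bigr => k _; rewrite scaleNr.
by under eq_bigr do rewrite mulrN; rewrite sumrN AB' oppr0.
Qed.

(** Let [Q] be R^n modulo the kernel of [A], embedded in R^m by [i]. The tensor of [u], the sum of
    the [e_j] (x) x_j, becomes the sum of the f_k (x) (Ax)_k, which is 0, so [u] is null by
    flatness. Reading [u] back in F^n through a section [s] of [pi] changes [x] only by trivial
    solutions. *)
Lemma flat_equationally_flat : flat F -> equationally_flat.
Proof.
move=> flatF m n A x Ax.
pose Rn : lmodType R^c := ('I_n -> (R^c)^o).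
pose Rm : lmodType R^c := ('I_m -> (R^c)^o).
pose column j : Rm := fun i => A i j.
have [|alpha alphaE] := @linear_pack _ Rn Rm
    (fun v => \sum_j (v j : R^c) *: column j).
  move=> r v w; rewrite scaler_sumr -big_split; apply: eq_bigr => j _ /=.
  by rewrite scalerA -scalerDl.
have alphaP v i : alpha v i = \sum_j A i j * v j by rewrite alphaE fct_sumE.
have [|Q [pi [pi_surj pi_ker]]] := @exists_quotient_module _ Rn [set v | alpha v = 0].
  split=> [|r v w /= v0 w0]; first exact: raddf0.
  by rewrite linearP v0 w0 scaler0 addr0.
have [s sP] := choice pi_surj.
have alpha_eq v w : pi v = pi w -> alpha v = alpha w.
  move=> vw; apply/eqP; rewrite -subr_eq0 -raddfB; apply/eqP/pi_ker.
  by rewrite linearB vw subrr.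
have [|i iE] := @linear_pack _ Q Rm (fun q => alpha (s q)).
  by move=> r p q; rewrite -linearP; apply: alpha_eq; rewrite linearP !sP.
have i_inj : injective i.
  by apply: raddf_inj => q iq0; have /pi_ker := etrans (esym (iE q)) iq0; rewrite sP.
have unit_triv (w : Rn) (y : F) : alpha w = 0 ->
    trivial_solution A (fun j => (w j : R) *: y).
  move=> w0; exists unit, (fun j _ => w j), (fun=> y); split=> [j|k _].
    by rewrite big_const card_unit /= addr0.
  by rewrite -alphaP w0.
(* [s] is linear only modulo the kernel of [alpha]. Thus [Phi] does not kill the tensor relations,
   but sends them to trivial solutions. *)
have [Phi PhiU] := freeg_lift (fun p : Q * F =>
  (fun j => (s p.1 j : R) *: p.2) : 'I_n -> F).
have triv_sub := trivial_solution_subgroup A.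
have PhiP u : tensor_null u -> trivial_solution A (Phi u).
  elim=> {u} [u [q q' y|q y y'|r q y]||u v _ Pu _ Pv].
  - rewrite raddfB raddfD !PhiU.
    rewrite (_ : _ - _ = fun j => ((s (q + q') - (s q + s q')) j : R) *: y).
      by apply: unit_triv; apply/pi_ker; rewrite linearB linearD !sP subrr.
    by apply/funext => j; rewrite scalerBl scalerDl.
  - rewrite raddfB raddfD !PhiU (_ : _ - _ = 0); first exact: triv_sub.1.
    by apply/eqP; rewrite subr_eq0; apply/eqP/funext => j; exact: scalerDr.
  - rewrite raddfB !PhiU.
    rewrite (_ : _ - _ = fun j => ((s ((r : R^c) *: q) - (r : R^c) *: s q) j : R) *: y).
      by apply: unit_triv; apply/pi_ker; rewrite linearB linearZ !sP subrr.
    apply/funext => j; rewrite scalerBl; congr +%R; congr -%R; exact: scalerA.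
  - by rewrite raddf0; exact: triv_sub.1.
  - by rewrite raddfB; exact: triv_sub.2.
pose e j : Rn := single j 1.
pose f k : Rm := single k 1.
have alpha_e j : alpha (e j) = \sum_k (A k j : R^c) *: f k.
  rewrite -[LHS]sum_single; apply: eq_bigr => k _.
  rewrite alphaP (bigD1 j) //= big1 => [|l lj].
    rewrite /e /single eqxx addr0 mulr1; apply/funext => h.
    rewrite -[RHS]/((if h == k then 1 else 0) * A k j).
    by case: eqP => _; rewrite ?mul0r ?mul1r.
  by rewrite /e /single (negbTE lj) mulr0.
pose u := \sum_j <<(pi (e j), x j)>> : {freeg (Q * F)}.
have u0 : tensor_null u.
  rewrite -[u]subr0; apply/tensor_eqP/(flatF _ _ _ i_inj).
  rewrite !raddf0 raddf_sum /= raddf_sum /=.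
  under eq_bigr => j _.
    rewrite tensor_map_tmul iE (alpha_eq _ (e j)) ?sP //.
    rewrite alpha_e.
    rewrite tmul_suml; under eq_bigr do rewrite tmulZ.
  over.
  rewrite exchange_big big1 // => k _.
  by rewrite -tmul_sumr Ax tmul0r.
have -> : x = (x - Phi u) + Phi u by rewrite subrK.
apply: (subgroupD triv_sub) (PhiP _ u0).
(* Term by term, the difference is [e j - s (pi (e j))], an element of the kernel of [alpha], times
   [x j]. *)
rewrite -[X in X - _]sum_single /u raddf_sum -sumrB.
elim/big_ind: _ => [||j _]; first exact: triv_sub.1.
  by move=> a b; apply: (subgroupD triv_sub).
rewrite PhiU (_ : _ - _ = fun l => ((e j - s (pi (e j))) l : R) *: x j).
  by apply: unit_triv; apply/pi_ker; rewrite linearB sP subrr.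
apply/funext => l; rewrite scalerBl; congr (_ - _).
by rewrite /e /single; case: eqP; rewrite ?scale1r ?scale0r.
Qed.
(** A list of pairs stands for a formal linear combination of elements of [F]. *)
Definition respects (b : F -> R) (rel : seq (R * F)) : Prop :=
  \sum_(p <- rel) p.1 * b p.2 = 0.

(** The finitely many relations form one matrix whose columns are the distinct elements of [F] that
    occur in [X] or in [rels]. On these elements [b] reads off the rows of the trivializing matrix
    [B]; elsewhere it is an empty sum. *)
Lemma equationally_flat_seq (X : seq F) (rels : seq (seq (R * F))) :
    equationally_flat ->
    (forall rel, rel \in rels -> \sum_(p <- rel) p.1 *: p.2 = 0) ->
  exists (K : finType) (b : F -> K -> R) (z : K -> F),
    (forall y, y \in X -> y = \sum_k b y k *: z k) /\
    (forall rel k, rel \in rels -> respects (b^~ k) rel).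
Proof.
move=> eqF rel0.
pose Y := undup (X ++ flatten [seq [seq p.2 | p <- rel] | rel <- rels]).
pose x (j : 'I_(size Y)) := nth 0 Y j.
have x_inj : injective x.
  move=> j k /eqP; rewrite nth_uniq ?undup_uniq // => /eqP; exact: val_inj.
have xY y : y \in Y -> exists j, x j = y.
  by move=> Yy; exists (Ordinal (etrans (index_mem y Y) Yy)); rewrite /x nth_index.
have sum_x (V : zmodType) j (G : 'I_(size Y) -> V) :
    \sum_(k | x k == x j) G k = G j.
  by rewrite (big_pred1 j) // => k; rewrite /= (inj_eq x_inj).
have relY rel p : rel \in rels -> p \in rel -> p.2 \in Y.
  move=> relP pP; rewrite mem_undup mem_cat; apply/orP; right.
  apply/flattenP; exists [seq p.2 | p <- rel]; first exact: map_f.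
  exact: map_f.
(* An element may occur several times in a relation, so its coefficients are added up. *)
pose A (i : 'I_(size rels)) j := \sum_(p <- nth [::] rels i | p.2 == x j) p.1.
have AE (i : 'I_(size rels)) (V : zmodType) (G : R -> 'I_(size Y) -> V) :
    (forall j, zmod_morphism (G^~ j)) ->
    \sum_j G (A i j) j =
    \sum_(p <- nth [::] rels i) \sum_(j | x j == p.2) G p.1 j.
  move=> GB; under eq_bigr => j _.
    have [g gE] := additive_pack (GB j).
    rewrite -[G _ _]gE raddf_sum.
    under eq_bigr do rewrite gE.
  over.
  rewrite (exchange_big_dep xpredT) //=; apply: eq_bigr => p _.
  by apply: eq_bigl => j; rewrite eq_sym.
have [|K [B [z [xE AB]]]] := eqF _ _ A x.
  move=> i; rewrite (AE i _ (fun r j => r *: x j)); last first.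
    by move=> j r r'; rewrite scalerBl.
  rewrite -[RHS](rel0 _ (mem_nth [::] (ltn_ord i))); apply: eq_big_seq => p pP.
  have [j <-] := xY _ (relY _ _ (mem_nth [::] (ltn_ord i)) pP).
  by rewrite sum_x.
exists K, (fun y k => \sum_(j | x j == y) B j k), z; split=> [y Xy|rel k relP].
  have [|j <-] := xY y; first by rewrite mem_undup mem_cat Xy.
  by rewrite {1}xE; apply: eq_bigr => k _; rewrite sum_x.
have [i <-] : exists i : 'I_(size rels), nth [::] rels i = rel.
  by exists (Ordinal (etrans (index_mem rel rels) relP)); rewrite nth_index.
rewrite /respects -[RHS](AB i k) (AE i _ (fun r j => r * B j k)); last first.
  by move=> j r r'; rewrite mulrBl.
by apply: eq_bigr => p _; rewrite mulr_sumr.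
Qed.

(** A derivation of nullity uses finitely many additivity and scaling identities in [F]. A function
    [b] that obeys just these, without being linear on [F], already makes the map k (x) y to k b(y)
    vanish on [v]. *)
Lemma tensor_null_relations (K : lmodType R^c) (v : {freeg (K * F)}) :
    tensor_null v ->
  exists2 rels : seq (seq (R * F)),
    (forall rel, rel \in rels -> \sum_(p <- rel) p.1 *: p.2 = 0) &
    forall (b : F -> R) (c : {additive {freeg (K * F)} -> K}),
      (forall rel, rel \in rels -> respects b rel) ->
      (forall k y, c <<(k, y)>> = (b y : R^c) *: k) -> c v = 0.
Proof.
elim=> {v} [v [k k' y|k y y'|r k y]||u v _ [ru ru0 cu] _ [rv rv0 cv]].
- exists [::] => // b c _ cE.
  by rewrite raddfB raddfD /= !cE scalerDr subrr.
- exists [:: [:: (1, y + y'); (-1, y); (-1, y')]].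
    move=> rel; rewrite inE => /eqP ->; rewrite !big_cons big_nil /=.
    by rewrite scale1r !scaleN1r addr0 -opprD subrr.
  move=> b c br cE; have := br _ (mem_head _ _).
  rewrite /respects !big_cons big_nil /= mul1r !mulN1r addr0 -opprD.
  move=> /eqP; rewrite subr_eq0 => /eqP bD.
  by rewrite raddfB raddfD /= !cE bD scalerDl subrr.
- exists [:: [:: (r, y); (-1, r *: y)]].
    move=> rel; rewrite inE => /eqP ->; rewrite !big_cons big_nil /=.
    by rewrite scaleN1r addr0 subrr.
  move=> b c br cE; have := br _ (mem_head _ _).
  rewrite /respects !big_cons big_nil /= mulN1r addr0.
  move=> /eqP; rewrite subr_eq0 => /eqP bZ.
  by rewrite raddfB /= !cE scalerA -bZ subrr.
- by exists [::] => // b c _ _; rewrite raddf0.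
- exists (ru ++ rv) => [rel|b c br cE].
    by rewrite mem_cat => /orP[/ru0|/rv0].
  rewrite raddfB (cu b c) ?(cv b c) ?subrr // => rel relP; apply: br;
    by rewrite mem_cat relP ?orbT.
Qed.

(** The identities behind the nullity of the image of [u] yield coordinates [b] and vectors [z] with
    y the sum of the b_k(y) z_k on the support of [u]. The resulting coordinates of [u] vanish,
    since their images under the injective [i] do, and [t] is the sum of these coordinates tensored
    with the [z k]. *)
Lemma equationally_flat_flat : equationally_flat -> flat F.
Proof.
move=> eqF L K i i_inj; apply: raddf_inj => t it0; rewrite -[t]reprK.
set u := repr t.
have [|rels rels0 rels_c] := @tensor_null_relations K (freeg_tensor_map i u).
  by rewrite -[X in tensor_null X]subr0; apply/tensor_eqP; rewrite raddf0.
have [J [b [z [bz bP]]]] := equationally_flat_seq [seq p.2 | p <- dom u] eqF rels0.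
(* As [b] need not be linear, these maps exist on the free group and not on the tensor product. *)
have cP (L' : lmodType R^c) k := freeg_lift (fun p : L' * F => (b p.2 k : R^c) *: p.1).
have [c cE] := choice (cP L).
have c0 k : c k u = 0.
  have [c' c'E] := cP K k; apply: i_inj; rewrite raddf0.
  rewrite -(rels_c (b^~ k) c') => [|rel relP|l y]; last by rewrite c'E.
    move: (u); apply: freeg_ind_generator; rewrite ?raddf0 //.
      move=> p; rewrite freeg_tensor_mapU cE c'E; exact: linearZ.
    by move=> v w Pv Pw; rewrite !raddfB; congr (_ - _).
  exact: bP.
rewrite -[u]freeg_sumE raddf_sum /=.
transitivity (\sum_k tmul (c k u) (z k) : tensor L F); last first.
  by rewrite big1 // => k _; rewrite c0 tmul0l.
under [RHS]eq_bigr do rewrite -[u]freeg_sumE raddf_sum tmul_suml.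
rewrite exchange_big; apply: eq_big_seq => p pu.
have Umul (D : zmodType) (h : {additive {freeg (L * F)} -> D}) :
    h <<coeff p u *g p>> = h <<p>> *~ coeff p u.
  by rewrite -raddfMz freegU_mulz intz.
rewrite [LHS]Umul; under eq_bigr do rewrite Umul cE.
have tmulMz x y (n : int) : tmul (x *~ n) y = tmul x y *~ n :> tensor L F.
  have [|h hE] := @additive_pack L (tensor L F) (fun x => tmul x y).
    by move=> x1 x2; apply/eqP; rewrite eq_sym subr_eq -tmulDl subrK.
  by rewrite -!hE raddfMz.
under eq_bigr do rewrite tmulMz tmulZ.
rewrite -mulrz_suml -tmul_sumr -bz ?map_f //.
by case: p pu {Umul}.
Qed.

End EquationalFlatness.

(** * Small flat quotients *)

Lemma equationally_flat_regular (R : pzRingType) :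
  equationally_flat (R^o : lmodType R).
Proof.
move=> m n A x Ax; exists unit, (fun j _ => x j), (fun=> 1); split=> [j|i _].
  by rewrite big_const card_unit /= addr0 [RHS]mulr1.
exact: Ax.
Qed.

Section Purity.
Variables (R : pzRingType) (F : lmodType R).

Definition pure (P : set F) : Prop :=
  forall m n (A : 'I_m -> 'I_n -> R) (x : 'I_n -> F),
    (forall i, P (\sum_j A i j *: x j)) ->
  exists2 z : 'I_n -> F, forall j, P (z j) &
    forall i, \sum_j A i j *: z j = \sum_j A i j *: x j.

Lemma lincombB n (a : 'I_n -> R) (x y : 'I_n -> F) :
  \sum_j a j *: (x j - y j) = \sum_j a j *: x j - \sum_j a j *: y j.
Proof. by rewrite -sumrB; apply: eq_bigr => j _; rewrite scalerBr. Qed.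

(** A solution in [Q] lifts to one modulo [P]; purity supplies a correction in [P] that makes the
    lift an exact solution in [F], where it is trivial. *)
Lemma equationally_flat_pure_quotient (P : set F) (Q : lmodType R)
    (pi : {linear F -> Q}) :
    equationally_flat F -> pure P ->
    (forall q, exists x, pi x = q) -> (forall x, pi x = 0 <-> P x) ->
  equationally_flat Q.
Proof.
move=> eqF pureP pi_surj pi_ker m n A q Aq.
have [x xq] := choice (fun j => pi_surj (q j)).
have [|z Pz Az] := pureP _ _ A x.
  move=> i; apply/pi_ker; rewrite linear_sum -[RHS](Aq i).
  by apply: eq_bigr => j _; rewrite linearZ /= xq.
have [|K [B [y [xE AB]]]] := eqF _ _ A (fun j => x j - z j).
  by move=> i; rewrite lincombB Az subrr.
exists K, B, (fun k => pi (y k)); split=> // j.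
rewrite -xq (_ : pi (x j) = pi (x j - z j)); last first.
  by rewrite linearB ((pi_ker _).2 (Pz j)) subr0.
by rewrite xE linear_sum; apply: eq_bigr => k _; rewrite linearZ.
Qed.

Lemma chain_finite_bound (C : set (set F)) m (g : 'I_m -> F) :
    C !=set0 -> total_on C subset -> (forall i, (\bigcup_(X in C) X) (g i)) ->
  exists2 X, C X & forall i, X (g i).
Proof.
move=> [X0 CX0] Ctot Cg.
suff [X CX Xg] : exists2 X, C X & forall i, i \in enum 'I_m -> X (g i).
  by exists X => // i; apply: Xg; rewrite mem_enum.
elim: (enum _) => [|i s [X CX Xg]]; first by exists X0.
have [Y CY Yg] := Cg i; have [XY|YX] := Ctot _ _ CX CY.
  exists Y => // k; rewrite inE => /orP[/eqP -> //|/Xg]; exact: XY.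
by exists X => // k; rewrite inE => /orP[/eqP ->|/Xg//]; exact: YX.
Qed.

End Purity.

(* [Sol A j ts] stands for the j-th coordinate of the chosen solution of the system
   A x = ts. *)
Inductive term (R : pzRingType) : Type :=
| Var
| Add of term R & term R
| Scale of R & term R
| Sol (m n : nat) of ('I_m -> 'I_n -> R) & 'I_n & ('I_m -> term R).

Arguments Var {R}.

Section SmallQuotient.
Variables (R : pzRingType) (F N : lmodType R) (f : {linear F -> N}).

Definition kernel_pure (P : set F) : Prop :=
  [/\ submodule P, pure P & forall x, P x -> f x = 0].

(** Zorn's lemma starts from the zero submodule. Purity passes to the union of a chain because the
    finitely many right-hand sides of a system lie in a single member. *)
Lemma exists_maximal_kernel_pure : exists2 P, kernel_pure P &
  forall Q, kernel_pure Q -> P `<=` Q -> Q `<=` P.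
Proof.
have [|C C0 Cgood Ctot|P [goodP _ maxP]] :=
  @exists_maximal_above F kernel_pure [set x | x = 0].
- split=> [|m n A x Ax|x ->]; last exact: raddf0.
    by split=> [//|r x y -> ->]; rewrite scaler0 addr0.
  exists (fun=> 0) => // i; rewrite Ax big1 // => j _; exact: scaler0.
- split=> [|m n A x Ax|x [X /Cgood[_ _ X0] /X0 //]].
    split; first by have [X CX] := C0; exists X => //; have [[]] := Cgood X CX.
    move=> r x y [X CX Xx] [Y CY Yy]; have [XY|YX] := Ctot _ _ CX CY.
      by exists Y => //; have [[_ YL] _ _] := Cgood Y CY; apply: YL => //; exact: XY.
    by exists X => //; have [[_ XL] _ _] := Cgood X CX; apply: XL => //; exact: YX.
  have [X CX XA] := chain_finite_bound C0 Ctot Ax.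
  have [_ pureX _] := Cgood X CX; have [z Xz Az] := pureX _ _ A x XA.
  by exists z => // j; exists X.
- by exists P.
Qed.

Variables (P : set F) (goodP : kernel_pure P).

Let subP : subgroup P.
Proof. by have [/submodule_subgroup] := goodP. Qed.

(* Two right-hand sides in the same coset of A F^n + P^m are assigned solutions
   relative to the same representative, so that the difference of the solutions
   solves the difference of the systems. *)
Lemma exists_relative_solution m n (A : 'I_m -> 'I_n -> R) :
  exists sol : ('I_m -> F) -> 'I_n -> F, forall y y',
    (exists x, forall i, P (\sum_j A i j *: x j - (y i - y' i))) ->
    forall i, P (\sum_j A i j *: (sol y j - sol y' j) - (y i - y' i)).
Proof.
pose eqv y y' := exists x, forall i, P (\sum_j A i j *: x j - (y i - y' i)).
have shift (a a' y y' z : F) : a - (y - z) - (a' - (y' - z)) = a - a' - (y - y').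
  rewrite [- (a' - _)]opprD opprK addrACA; congr +%R.
  by rewrite addrC opprB addrA subrK opprB.
have eqvB y y' z : eqv y z -> eqv y' z -> eqv y y'.
  move=> [x Px] [x' Px']; exists (fun j => x j - x' j) => i.
  by rewrite lincombB -(shift _ _ _ _ (z i)); exact: subP.2.
have eqvxx y : eqv y y.
  exists (fun=> 0) => i; rewrite subrr subr0 big1; first exact: subP.1.
  by move=> j _; exact: scaler0.
have eqvC y y' : eqv y y' -> eqv y' y by exact: eqvB (eqvxx y').
(* A canonical representative of the class of [y]; the default 0 is never taken, as each class
   contains [y]. *)
pose rho y := xget 0 [set z | eqv y z].
have rhoP y : eqv y (rho y).
  by apply: (@xgetPex _ 0 [set z | eqv y z]); exists y; exact: eqvxx.
have rho_eq y y' : eqv y y' -> rho y = rho y'.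
  move=> yy'; congr xget; apply/seteqP; split=> [z /= yz|z /= y'z].
    exact: eqvB (eqvC _ _ yy') (eqvC _ _ yz).
  exact: eqvB yy' (eqvC _ _ y'z).
have [sol solP] := choice rhoP.
exists sol => y y' yy' i; rewrite lincombB -(shift _ _ _ _ (rho y i)).
by apply: subP.2; [|rewrite (rho_eq _ _ yy')]; exact: solP.
Qed.

Hypothesis maxP : forall Q, kernel_pure Q -> P `<=` Q -> Q `<=` P.

Fixpoint term_eval (a : F) (t : term R) : F :=
  match t with
  | Var => a
  | Add t1 t2 => term_eval a t1 + term_eval a t2
  | Scale r t1 => r *: term_eval a t1
  | Sol m n A j ts =>
      projT1 (cid (exists_relative_solution A)) (fun i => term_eval a (ts i)) j
  end.

(** The set [P'] of the differences [d t] modulo [P] is closed under linear combinations thanks to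
    [Add] and [Scale], is pure thanks to [Sol], and is killed by [f] by hypothesis. Maximality gives
    that [P'] lies in [P], and [d Var] is [a - b]. *)
Lemma term_eval_separates a b :
  (forall t, f (term_eval a t) = f (term_eval b t)) -> P (a - b).
Proof.
move=> fab; have [sP pureP P0] := goodP; pose d t := term_eval a t - term_eval b t.
pose P' := [set w | exists t, P (w - d t)].
have dZD r t t' : d (Add (Scale r t) t') = r *: d t + d t'.
  by rewrite /d /= opprD addrACA -scalerBr.
(* The terms have no constant; [Scale 0 Var] plays the role of zero. *)
have d0 : d (Scale 0 Var) = 0 by rewrite /d /= !scale0r subrr.
have P'd t : P' (d t) by exists t; rewrite ?subrr //; exact: sP.1.
apply: (maxP (Q := P')); last exact: (P'd Var); last first.
  by move=> x Px; exists (Scale 0 Var); rewrite // d0 subr0.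
split=> [|m n A x Ax|x [t Pt]]; last first.
- by rewrite -[x](subrK (d t)) raddfD /= P0 // add0r /d raddfB /= fab subrr.
(* The given [x] witnesses that the two evaluations of the right-hand sides differ by a solvable
   system modulo [P], so the chosen solutions are compatible. Purity of [P] then removes the
   remaining error. *)
- have [t tP] := choice Ax; pose s j := d (Sol A j t).
  have Ps i : P (\sum_j A i j *: s j - d (t i)).
    by rewrite /s /d /=; case: cid => sol /= solP; apply: solP; exists x.
  have [|z Pz Az] := pureP _ _ A (fun j => x j - s j).
    move=> i; rewrite lincombB; have := subP.2 _ _ (tP i) (Ps i).
    by rewrite [- (\sum_j _ - _)]opprB addrA subrK.
  exists (fun j => z j + s j) => [j|i].
    by exists (Sol A j t); rewrite addrK.
  rewrite -[RHS](subrK (\sum_j A i j *: s j)) -lincombB -Az -big_split.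
  by apply: eq_bigr => j _; rewrite scalerDr.
- split=> [|r x y [t Pt] [t' Pt']].
    by exists (Scale 0 Var); rewrite d0 subr0; exact: sP.1.
  exists (Add (Scale r t) t'); rewrite dZD opprD addrACA -scalerBr.
  exact: sP.2.
Qed.


End SmallQuotient.

(** The target of [e] does not depend on [F]: this bounds uniformly the size of the flat modules
    needed to factor all maps from flat modules to [N]. *)
Lemma small_flat_quotient (R : pzRingType) (F N : lmodType R) (f : {linear F -> N}) :
    equationally_flat F ->
  exists (G : lmodType R) (p : {linear F -> G}) (g : {linear G -> N})
      (e : G -> (term R -> N)),
    [/\ equationally_flat G, g \o p =1 f & injective e].
Proof.
move=> eqF; have [P goodP maxP] := exists_maximal_kernel_pure f.
have [sP pureP P0] := goodP.
have [G [pi [pi_surj pi_ker]]] := exists_quotient_module sP.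
have [s sK] := choice pi_surj.
have f_eq x y : pi x = pi y -> f x = f y.
  move=> xy; apply/eqP; rewrite -subr_eq0 -linearB; apply/eqP/P0/pi_ker.
  by rewrite linearB xy subrr.
have [|g gE] := @linear_pack R G N (fun q => f (s q)).
  by move=> r p q; rewrite -linearP; apply: f_eq; rewrite linearP !sK.
exists G, pi, g, (fun q t => f (term_eval goodP (s q) t)); split.
- exact: equationally_flat_pure_quotient eqF pureP pi_surj pi_ker.
- by move=> x /=; rewrite gE; apply: f_eq; rewrite sK.
move=> p q pq; rewrite -[p]sK -[q]sK; apply/eqP; rewrite -subr_eq0 -linearB.
apply/eqP/pi_ker/(term_eval_separates (goodP := goodP) maxP) => t.
exact: (congr1 (fun e => e t) pq).
Qed.

(** * Flat precovers *)

Section DirectSum.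
Variables (R : pzRingType) (J : choiceType) (F : J -> lmodType R).

Definition dprod : Type := forall j, F j.

HB.instance Definition _ := gen_eqMixin dprod.
HB.instance Definition _ := gen_choiceMixin dprod.

Section Operations.
Implicit Types u v w : dprod.

Let dzero : dprod := fun=> 0.
Let dopp u : dprod := fun j => - u j.
Let dadd u v : dprod := fun j => u j + v j.

Fact dprod_addA : associative dadd.
Proof. by move=> u v w; apply/functional_extensionality_dep => j; exact: addrA. Qed.
Fact dprod_addC : commutative dadd.
Proof. by move=> u v; apply/functional_extensionality_dep => j; exact: addrC. Qed.
Fact dprod_add0 : left_id dzero dadd.
Proof. by move=> u; apply/functional_extensionality_dep => j; exact: add0r. Qed.
Fact dprod_addN : left_inverse dzero dopp dadd.
Proof. by move=> u; apply/functional_extensionality_dep => j; exact: addNr. Qed.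

HB.instance Definition _ :=
  GRing.isZmodule.Build dprod dprod_addA dprod_addC dprod_add0 dprod_addN.

Let dscale (r : R) u : dprod := fun j => r *: u j.

Fact dprod_scaleA a b u : dscale a (dscale b u) = dscale (a * b) u.
Proof. by apply/functional_extensionality_dep => j; exact: scalerA. Qed.
Fact dprod_scale1 : left_id 1 dscale.
Proof. by move=> u; apply/functional_extensionality_dep => j; exact: scale1r. Qed.
Fact dprod_scaleDr : right_distributive dscale +%R.
Proof. by move=> a u v; apply/functional_extensionality_dep => j; exact: scalerDr. Qed.
Fact dprod_scaleDl u : {morph dscale^~ u : a b / a + b}.
Proof. by move=> a b; apply/functional_extensionality_dep => j; exact: scalerDl. Qed.

HB.instance Definition _ := GRing.Zmodule_isLmodule.Build R dprod
  dprod_scaleA dprod_scale1 dprod_scaleDr dprod_scaleDl.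

End Operations.

Definition supported (s : seq J) (u : forall j, F j) : Prop :=
  forall j, j \notin s -> u j = 0.

Definition finsupp : pred dprod := fun u => `[< exists s, supported s u >].

Fact finsupp_submod_closed : submod_closed finsupp.
Proof.
split=> [|r u v /asboolP[s su] /asboolP[t tv]]; apply/asboolP.
  by exists [::].
exists (s ++ t) => j; rewrite mem_cat negb_or => /andP[js jt].
by rewrite -[LHS]/(r *: u j + v j) su // tv // scaler0 addr0.
Qed.

HB.instance Definition _ := GRing.isSubmodClosed.Build R dprod finsupp
  finsupp_submod_closed.

Record dsum := DSum { dsum_val :> dprod; _ : finsupp dsum_val }.

Definition dsum_fun (u : dsum) : forall j, F j := dsum_val u.
Coercion dsum_fun : dsum >-> Funclass.

HB.instance Definition _ := [isSub for dsum_val].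
HB.instance Definition _ := [Choice of dsum by <:].
HB.instance Definition _ := [SubChoice_isSubLmodule of dsum by <:].

Lemma dsum_supportP (u : dsum) : exists2 s, uniq s & supported s (dsum_fun u).
Proof.
case: u => u /= /[dup] /asboolP[s su] _; exists (undup s); first exact: undup_uniq.
by move=> j; rewrite mem_undup; exact: su.
Qed.

Lemma dsum_ext (u v : dsum) : (forall j, u j = v j) -> u = v.
Proof. by move=> uv; apply/val_inj/functional_extensionality_dep. Qed.

Fact dsum_inj_subproof j (x : F j) : finsupp (dfwith (fun k : J => 0 : F k) x).
Proof.
apply/asboolP; exists [:: j] => k; rewrite inE => kj.
by rewrite dfwith_out // eq_sym.
Qed.

Definition dsum_inj j (x : F j) : dsum := DSum (dsum_inj_subproof x).

Fact dsum_inj_is_linear j : linear (@dsum_inj j).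
Proof.
move=> r x y; apply: dsum_ext => k.
rewrite -[RHS]/(r *: dfwith (fun k : J => 0 : F k) x k + dfwith (fun k : J => 0 : F k) y k) /=.
have [jk|jk] := eqVneq j k; first by rewrite -jk !dfwith_in.
by rewrite !dfwith_out // scaler0 addr0.
Qed.

HB.instance Definition _ j := GRing.isLinear.Build R (F j) dsum _ (@dsum_inj j)
  (dsum_inj_is_linear (j := j)).

Lemma dsum_decomp (u : dsum) s : uniq s -> supported s (dsum_fun u) ->
  u = \sum_(j <- s) dsum_inj (u j).
Proof.
move=> s_uniq su; apply: dsum_ext => k.
rewrite (big_morph (fun v : dsum => v k) (id1 := 0) (op1 := +%R)) //=.
have [ks|ks] := boolP (k \in s); last first.
  rewrite su // big_seq big1 // => j js; rewrite dfwith_out //.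
  by apply: contraNneq ks => <-.
rewrite (bigD1_seq k) //= dfwith_in big1 ?addr0 // => j jk.
by rewrite dfwith_out.
Qed.

(** The sum may run over any duplicate-free list that supports [u], since extra indices contribute
    0; linearity is checked on a list common to both arguments. *)
Lemma dsum_lift (N : lmodType R) (f : forall j, {linear F j -> N}) :
  exists g : {linear dsum -> N}, forall j x, g (dsum_inj x) = f j x.
Proof.
have wd (u : dsum) : exists y, forall s, uniq s -> supported s (dsum_fun u) ->
    y = \sum_(j <- s) f j (u j).
  have [s s_uniq su] := dsum_supportP u.
  exists (\sum_(j <- s) f j (u j)) => t t_uniq tu.
  have rm r : \sum_(j <- r) f j (u j) = \sum_(j <- [seq j <- r | u j != 0]) f j (u j).
    rewrite big_filter [LHS](bigID (fun j => u j != 0)) /=.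
    by rewrite [X in _ + X]big1 ?addr0 // => j /negPn /eqP ->; rewrite raddf0.
  rewrite rm [RHS]rm; apply: perm_big; apply: uniq_perm; rewrite ?filter_uniq //.
  move=> j; rewrite !mem_filter; case: eqVneq => //= uj.
  have mem r : supported r (dsum_fun u) -> j \in r.
    by move=> ru; apply: contraNT uj => /ru ->.
  by rewrite !mem.
have [g gP] := choice wd.
have [|g' g'E] := @linear_pack R dsum N g.
  move=> r u v; have [s s_uniq su] := dsum_supportP u.
  have [t t_uniq tv] := dsum_supportP v; pose w := undup (s ++ t).
  have w_uniq : uniq w by exact: undup_uniq.
  have wu : supported w (dsum_fun u).
    by move=> j; rewrite mem_undup mem_cat negb_or => /andP[/su].
  have wv : supported w (dsum_fun v).
    by move=> j; rewrite mem_undup mem_cat negb_or => /andP[_ /tv].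
  rewrite (gP u w) // (gP v w) // (gP _ w) //; last first.
    by move=> j jw; rewrite -[LHS]/(r *: u j + v j) wu // wv // scaler0 addr0.
  rewrite scaler_sumr -big_split; apply: eq_bigr => j _.
  exact: (linearP (f j) r (u j) (v j)).
exists g' => j x; rewrite g'E (gP _ [:: j]) //.
  by rewrite big_seq1 /= dfwith_in.
by move=> k; rewrite inE => kj; rewrite /= dfwith_out // eq_sym.
Qed.

(** The finitely many entries of [x] are supported on one finite list of indices, so [x] is a finite
    sum of solutions living in single summands. Each is trivial, and trivial solutions form a
    subgroup. *)
Lemma equationally_flat_dsum :
  (forall j, equationally_flat (F j)) -> equationally_flat (dsum : lmodType R).
Proof.
move=> eqF m n A x Ax; have [s sx] := choice (fun l => let: ex_intro2 t _ tP :=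
  dsum_supportP (x l) in ex_intro (fun t => supported t (dsum_fun (x l))) t tP).
pose t := undup (flatten [seq s l | l <- enum 'I_n]).
have xE l : x l = \sum_(j <- t) dsum_inj (x l j).
  apply: dsum_decomp; first exact: undup_uniq.
  move=> j jt; apply: sx; apply: contra jt => jsl.
  rewrite mem_undup; apply/flattenP; exists (s l) => //.
  by apply: map_f; rewrite mem_enum.
have tsA := @trivial_solution_subgroup R dsum m n A.
rewrite (_ : x = \sum_(j <- t) (fun l => dsum_inj (x l j))); last first.
  by apply/funext => l; rewrite fct_sumE -xE.
elim/big_ind: _ => [||j _]; first exact: tsA.1.
  by move=> a b; apply: (subgroupD tsA).
have [|K [B [y [xjE AB]]]] := eqF j _ _ A (fun l => x l j).
  move=> i; have := congr1 (fun u : dsum => u j) (Ax i).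
  rewrite (big_morph (fun v : dsum => v j) (id1 := 0) (op1 := +%R)) //.
exists K, B, (fun k => dsum_inj (y k)); split=> // l.
by rewrite xjE linear_sum; apply: eq_bigr => k _; rewrite linearZ.
Qed.

End DirectSum.

Section FlatPrecover.
Variables (R : pzRingType) (N : lmodType R).

Let X : Type := term R -> N.

Record realization := Realization {
  realization_mod : lmodType R;
  realization_map : {linear realization_mod -> N};
  realization_emb : realization_mod -> X;
  realization_flat : equationally_flat realization_mod;
  realization_inj : injective realization_emb }.

(* The addition, the scaling and the map to N, transported to X: modules with the
   same code are isomorphic over N, and codes, unlike modules, form a type that may
   index a direct sum in the universe of modules. *)
Definition code : Type :=
  ((X -> X -> X -> Prop) * (R -> X -> X -> Prop) * (X -> N -> Prop))%type.

Definition code_of (c : realization) : code :=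
  let e := @realization_emb c in
  ((fun a b d => exists x y, [/\ a = e x, b = e y & d = e (x + y)]),
   (fun r a b => exists2 x, a = e x & b = e (r *: x)),
   (fun a n => exists2 x, a = e x & n = realization_map c x)).

(** Equal codes force the image of one embedding into that of the other, so elements can be matched
    through [X]; the coded graphs make this matching linear and compatible with the maps to [N]. *)
Lemma code_of_eq (c d : realization) : code_of c = code_of d ->
  exists theta : {linear realization_mod c -> realization_mod d},
    forall x, realization_map d (theta x) = realization_map c x.
Proof.
case: c => G g e eF e_inj; case: d => G' g' e' eF' e'_inj [/= eD eZ eN].
have toG x : exists x', e' x' = e x.
  have : exists2 z, e x = e z & g x = g z by exists x.
  by rewrite (congr1 (fun h => h (e x) (g x)) eN) => -[x' ex' _]; exists x'.
have [theta thetaE] := choice toG.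
have [|h hE] := @linear_pack R G G' theta.
  move=> r x y; apply: (e'_inj); rewrite thetaE.
  have : exists a b, [/\ e (r *: x) = e a, e y = e b & e (r *: x + y) = e (a + b)].
    by exists (r *: x), y.
  rewrite (congr1 (fun h => h (e (r *: x)) (e y) (e (r *: x + y))) eD).
  move=> [a [b [ea eb ->]]]; congr (e' (_ + _)); apply: (e'_inj).
    have : exists2 z, e x = e z & e (r *: x) = e (r *: z) by exists x.
    rewrite (congr1 (fun h => h r (e x) (e (r *: x))) eZ) => -[z ez].
    rewrite ea => ->; congr (e' (r *: _)); apply: (e'_inj).
    by rewrite thetaE.
  by rewrite thetaE.
exists h => x; rewrite hE.
have : exists2 z, e x = e z & g x = g z by exists x.
rewrite (congr1 (fun h => h (e x) (g x)) eN) => -[z ez ->].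
by congr (g' _); apply: (e'_inj); rewrite thetaE.
Qed.

(** The sum has one chosen realization for each code attained. A map from a flat module factors
    through some realization, which maps over [N] to the chosen one with the same code. *)
Lemma exists_flat_precover :
  exists (F : lmodType R) (g : {linear F -> N}), flat_precover g.
Proof.
pose J := {c : code | `[< exists d, code_of d = c >]}.
have selP (j : J) : exists d, code_of d = val j by apply/asboolP; exact: (valP j).
pose sel j := projT1 (cid (selP j)).
have selE j : code_of (sel j) = val j := projT2 (cid (selP j)).
have [g gE] := dsum_lift (fun j => realization_map (sel j)).
exists (dsum (fun j => realization_mod (sel j)) : lmodType R), g; split.
  apply/equationally_flat_flat/equationally_flat_dsum => j.
  exact: realization_flat.
move=> F' /flat_equationally_flat eqF' f.
have [G [p [q [e [eqG qp e_inj]]]]] := small_flat_quotient f eqF'.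
pose c := Realization q eqG e_inj.
have cP : `[< exists d, code_of d = code_of c >] by apply/asboolP; exists c.
pose j : J := exist _ (code_of c) cP.
have [|theta thetaE] := @code_of_eq c (sel j); first by rewrite selE.
exists (@dsum_inj _ _ _ j \o theta \o p) => x /=.
by rewrite gE thetaE; exact: qp.
Qed.

End FlatPrecover.

(** The regular module is flat, so the map from it that sends 1 to [y] lifts. *)
Lemma flat_precover_surjective (R : pzRingType) (F N : lmodType R)
    (g : {linear F -> N}) :
  flat_precover g -> forall y, exists x, g x = y.
Proof.
move=> [_ gP] y; have [|f fE] := @linear_pack R R^o N (fun r => (r : R) *: y).
  by move=> r a b; rewrite scalerDl scalerA.
have [|h hE] := gP (R^o : lmodType R) _ f.
  exact/equationally_flat_flat/equationally_flat_regular.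
by exists (h 1); rewrite [LHS]hE fE scale1r.
Qed.

Theorem proposition3p8 (R : pzRingType) (M N : lmodType R) :
  finitely_presented M ->
  (flat_precover_completing_domain M N <->
   absolutely_pure_domain M (character N : lmodType (R^c)%type)).
Proof.
move=> fpM; split=> [complN|pureN f F g gP]; last first.
  exact: lifts_of_absolutely_pure (flat_precover_surjective gP) pureN f.
apply: absolutely_pure_of_factor => // f.
have [F [g gP]] := exists_flat_precover N.
have [h hE] := complN f F g gP.
have [m [n [A [x0 [gen rel lift]]]]] := finitely_presentedP fpM.
(* The images under [h] of the generators satisfy the relations of [M] in the flat module [F], hence
   form a trivial solution. *)
have [|K [B [y [xE AB]]]] :=
    flat_equationally_flat gP.1 (A := A) (x := fun j => h (x0 j)).
  move=> i; transitivity (h (\sum_j A i j *: x0 j)); last by rewrite rel raddf0.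
  by rewrite linear_sum; apply: eq_bigr => j _; rewrite linearZ.
(* As AB = 0, each column of [B] solves the relations in [R] and defines a linear form on [M]; these
   forms factor [h] through a finite free module. *)
have [u uE] := choice (fun k => lift (R^o : lmodType R) (B^~ k) (AB^~ k)).
exists K, u, (fun k => g (y k)) => z; rewrite -hE /=.
have [c ->] := gen z; rewrite !linear_sum.
under [RHS]eq_bigr do rewrite linear_sum scaler_suml.
rewrite exchange_big; apply: eq_bigr => j _.
rewrite !linearZ /= xE linear_sum scaler_sumr; apply: eq_bigr => k _.
by rewrite !linearZ /= uE -scalerA.
Qed.
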